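(* Let $G$ be a finite simple bipartite graph and $k$ a positive integer. Then a $k$-restraint $r$ on $G$ belongs to $R_{\max}(G,k)$ if and only if, for each connected component $H$ of $G$, the restriction of $r$ to $V(H)$ is an alternating restraint on $H$.
   Context: A restraint $r$ on a graph $G$ assigns to each vertex $v$ a finite set $r(v)\subset\mathbb{N}$ of forbidden colours; a proper $x$-colouring $c$ of $G$ is permitted by $r$ if $c(v)\notin r(v)$ for all $v$, and $\pi_r(G,x)$ denotes the number of proper $x$-colourings permitted by $r$. If $G$ has $n$ vertices, a $k$-restraint is a restraint with $|r(v)|=k$ and $r(v)\subseteq\{1,2,\dots,kn\}$ for every vertex $v$. $R_{\max}(G,k)$ is the set of $k$-restraints $r$ on $G$ such that for every $k$-restraint $r'$ on $G$, $\pi_r(G,x)\geq\pi_{r'}(G,x)$ for all sufficiently large $x$. For a connected bipartite graph $H$ with bipartition $(V_1,V_2)$, a restraint on $H$ is alternating if each vertex gets exactly $k$ forbidden colours, it is constant on $V_1$ and constant on $V_2$, and $r(u)\cap r(v)=\emptyset$ for $u\in V_1$, $v\in V_2$. *)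

(* Defs.v *)
From HB Require Import structures.
From mathcomp Require Import all_boot finmap.

Set Implicit Arguments.
Unset Strict Implicit.
Unset Printing Implicit Defensive.

(* A simple graph on the vertex type [T] is a symmetric irreflexive relation
   [e : rel T]. *)
Section Graphs.
Variables (T : finType) (e : rel T).

(* A part may be empty, so that an isolated vertex is a connected bipartite
   graph. *)
Definition bipartition (V1 V2 : {set T}) : Prop :=
  [/\ V1 :|: V2 = [set: T], V1 :&: V2 = set0
    & forall u v : T, e u v ->
        (u \in V1) && (v \in V2) || (u \in V2) && (v \in V1)].

Definition bipartite : Prop := exists V1 V2 : {set T}, bipartition V1 V2.

Definition components : {set {set T}} :=
  [set [set v | connect e u v] | u in [set: T]].

Definition induced (H : {set T}) : rel {v : T | v \in H} :=
  fun u v => e (val u) (val v).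

End Graphs.

Arguments induced {T} e H.

Definition restraint (T : finType) : Type := T -> {fset nat}.

Definition restrict (T : finType) (r : restraint T) (H : {set T}) :
  restraint {v : T | v \in H} := fun v => r (val v).

Arguments restrict {T} r H.

(* The ordinal [i : 'I_x] stands for the colour [i.+1] of {1, ..., x}. *)
Definition colour (x : nat) (i : 'I_x) : nat := i.+1.

Section Restraints.
Variables (T : finType) (e : rel T).

Definition proper_colouring (x : nat) (c : {ffun T -> 'I_x}) : bool :=
  [forall u, forall v, e u v ==> (c u != c v)].

Definition permitted (r : restraint T) (x : nat) (c : {ffun T -> 'I_x}) : bool :=
  [forall v, colour (c v) \notin r v].

Definition num_permitted (r : restraint T) (x : nat) : nat :=
  #|[set c : {ffun T -> 'I_x} | proper_colouring c && permitted r c]|.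

Definition k_restraint (k : nat) (r : restraint T) : Prop :=
  forall v : T, #|` r v| = k /\ (forall i : nat, i \in r v -> 1 <= i <= k * #|T|).

Definition Rmax (k : nat) (r : restraint T) : Prop :=
  k_restraint k r /\
  forall r' : restraint T, k_restraint k r' ->
    exists N : nat, forall x : nat, N <= x ->
      num_permitted r' x <= num_permitted r x.

(* Meant for connected [e], where the bipartition is unique up to swapping the
   two parts. *)
Definition alternating (k : nat) (r : restraint T) : Prop :=
  (forall v : T, #|` r v| = k) /\
  exists V1 V2 : {set T},
    [/\ bipartition e V1 V2,
        {in V1 &, forall u v, r u = r v},
        {in V2 &, forall u v, r u = r v}
      & {in V1 & V2, forall u v, (r u `&` r v)%fset = fset0}].

End Restraints.

(* Main.v *)
(** Put M = k n, so that every k-restraint lives in the colours 1..M, and sort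
    the permitted colourings with M + y colours by the set S of vertices that
    receive a colour at most M. The restraint r only matters on S, whence
    pi_r(G, M + y) = sum over S of p_r(S) q_y(V - S), where q_y(V - S) counts the
    proper colourings of G - S with y colours and has order y^(n - |S|). Two
    restraints are therefore compared at the smallest S on which p differs.

    Call r balanced on S if, in G[S], adjacent vertices have disjoint forbidden
    sets and vertices with a common neighbour have equal ones; on all of G this
    says that r is alternating on each component. Recolouring each component of
    G[S] by a permutation of the colours shows that p_r(S) is the same for all
    restraints balanced on S. The smallest S on which r can fail to be balanced
    is an edge uv or an induced path uvw, and explicit counting of
    the colourings of these two graphs shows that p_r(S) is then strictly smaller
    than its balanced value. *)

Require Import Defs.
From HB Require Import structures.
From mathcomp Require Import all_boot fingroup perm finmap zify.

Set Implicit Arguments.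
Unset Strict Implicit.
Unset Printing Implicit Defensive.

(** * Walks with alternating values, and permutations of colours *)

(** Each step of a walk from [x] swaps the values [f x] and [f y]. The clause on the neighbours of
    [z] carries the value of the next step through the induction. *)
Lemma connect_two_valued (T : finType) (e : rel T) (X : Type) (f : T -> X) :
  symmetric e -> (forall u v w, e v u -> e v w -> f u = f w) ->
  forall x y z, e x y -> connect e x z ->
    (f z = f x /\ forall t, e z t -> f t = f y) \/
    (f z = f y /\ forall t, e z t -> f t = f x).
Proof.
move=> e_sym fE x y z xy /connectP[p + ->] {z}.
elim/last_ind: p => [_|p z IHp] /=; first by left; split=> // t xt; apply: fE xy.
rewrite rcons_path last_rcons => /andP[/IHp + ez] {IHp}.
set l := last x p in ez *.
have nbr t : e z t -> f t = f l by move=> zt; apply: fE zt _; rewrite e_sym.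
case=> -[fl fn]; [right | left]; split=> [|t /nbr ->]; rewrite ?fl ?(fn _ ez) //.
Qed.

(** List the first set, then the second, then the remaining colours. Sending each entry of the list
    for [A], [B] to the entry in the same position of the list for [A'], [B'] respects the
    blocks. *)
Lemma perm_map_disjoint (C : finType) (A B A' B' : {set C}) :
  [disjoint A & B] -> [disjoint A' & B'] -> #|A| = #|A'| -> #|B| = #|B'| ->
  exists s : {perm C}, s @: A = A' /\ s @: B = B'.
Proof.
pose l (A B : {set C}) := enum A ++ enum B ++ enum (~: (A :|: B)).
have l_mem D F x : x \in l D F.
  by rewrite !mem_cat !mem_enum !inE; case: (x \in D); case: (x \in F).
have l_uniq (D F : {set C}) : [disjoint D & F] -> uniq (l D F).
  move=> dDF; rewrite !cat_uniq !enum_uniq /= andbT; apply/andP; split.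
    apply/hasPn => x; rewrite mem_cat !mem_enum !inE.
    by case Dx: (x \in D); rewrite ?orbF //= (disjointFr dDF).
  by apply/hasPn => x; rewrite !mem_enum !inE => /norP[].
have l_size (D F : {set C}) : [disjoint D & F] -> size (l D F) = #|C|.
  move=> dDF; rewrite cardT; apply: perm_size.
  by apply: uniq_perm (l_uniq _ _ dDF) (enum_uniq _) _ => x; rewrite l_mem mem_enum.
move=> dAB dAB' cA cB.
pose g x := nth x (l A' B') (index x (l A B)).
have idx x : index x (l A B) < size (l A' B').
  by rewrite l_size // -(l_size _ _ dAB) index_mem.
have g_inj : injective g.
  move=> x y; rewrite /g (set_nth_default x) ?idx // => /eqP.
  rewrite nth_uniq ?idx ?l_uniq // => /eqP E.
  by rewrite -(nth_index x (l_mem A B x)) E nth_index.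
have sub (D D' : {set C}) : #|D| = #|D'| -> (forall x, x \in D -> g x \in D') ->
    perm g_inj @: D = D'.
  move=> cD gD; apply/eqP; rewrite eqEcard card_imset ?cD ?leqnn ?andbT; last exact: perm_inj.
  by apply/subsetP => _ /imsetP[x Dx ->]; rewrite permE gD.
exists (perm g_inj); split; apply: sub => // x xD.
  have xl : index x (enum A) < size (enum A') by rewrite -cardE -cA cardE index_mem mem_enum.
  by rewrite /g /l index_cat mem_enum xD nth_cat xl -mem_enum mem_nth.
have xl : index x (enum B) < size (enum B') by rewrite -cardE -cB cardE index_mem mem_enum.
have xA : x \in A = false by rewrite (disjointFl dAB).
rewrite /g /l index_cat mem_enum xA index_cat mem_enum xD nth_cat.
rewrite -!cardE cA ltnNge leq_addr /= addKn nth_cat xl -mem_enum mem_nth //.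
Qed.

(** * Colourings of induced subgraphs and balanced restraints *)

Section PartialColourings.
Variables (T : finType) (e : rel T).
Hypothesis e_sym : symmetric e.

Section Colours.
Variable C : finType.
Implicit Types (R : T -> {set C}) (S L : {set T}) (a : {ffun T -> option C}).

(* Colourings of the subgraph induced by [S], extended by [None] outside [S]. *)
Definition partial_colourings R S : {set {ffun T -> option C}} :=
  [set a : {ffun T -> option C} | [&& [forall v, (a v : bool) == (v \in S)],
     [forall u, forall v, e u v ==> (u \in S) ==> (a u != a v)]
   & [forall v, if a v is Some j then j \notin R v else true]]].

Lemma partial_colouringsP R S a :
  reflect [/\ forall v, (a v : bool) = (v \in S),
              forall u v, e u v -> u \in S -> a u != a v
            & forall v j, a v = Some j -> j \notin R v]
          (a \in partial_colourings R S).
Proof.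
rewrite inE; apply: (iffP and3P) => -[dom prop perm]; split.
- by move=> v; apply/eqP/(forallP dom).
- by move=> u v uv uS; move/forallP/(_ u)/forallP/(_ v): prop; rewrite uv uS.
- by move=> v j av; move/forallP/(_ v): perm; rewrite av.
- by apply/forallP => v; rewrite dom.
- by apply/'forall_forallP => u v; apply/implyP=> uv; apply/implyP; apply: prop.
- by apply/forallP => v; case av: (a v) => [j|] //; apply: perm av.
Qed.

Lemma card_pfamily_prod S (F : T -> pred (option C)) :
  #|pfamily None S F| = \prod_(v in S) #|F v|.
Proof. by rewrite card_pfamily foldrE big_map big_enum. Qed.

(** Only edges and pairs of edges with a common end are tested, so any failure is already visible on
    two or three vertices. *)
Definition balanced R S : bool :=
  [forall u in S, forall v in S, e u v ==> [disjoint R u & R v]] &&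
  [forall u in S, forall v in S, forall w in S,
     e v u ==> e v w ==> (R u == R w)].

Lemma balancedP R S :
  reflect ((forall u v, u \in S -> v \in S -> e u v -> [disjoint R u & R v]) /\
           (forall u v w, u \in S -> v \in S -> w \in S ->
              e v u -> e v w -> R u = R w))
          (balanced R S).
Proof.
apply: (iffP andP) => -[dis com]; split.
- by move=> u v uS vS uv; move/forall_inP/(_ u uS)/forall_inP/(_ v vS): dis; rewrite uv.
- move=> u v w uS vS wS vu vw; apply/eqP.
  by move/forall_inP/(_ u uS)/forall_inP/(_ v vS)/forall_inP/(_ w wS): com; rewrite vu vw.
- by apply/forall_inP=> u uS; apply/forall_inP=> v vS; apply/implyP; apply: dis.
- apply/forall_inP=> u uS; apply/forall_inP=> v vS; apply/forall_inP=> w wS.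
  by apply/implyP=> vu; apply/implyP=> vw; apply/eqP; apply: com vw.
Qed.

Lemma balancedW R S : balanced R [set: T] -> balanced R S.
Proof.
by case/balancedP=> dis com; apply/balancedP; split=> [u v|u v w] *;
  [apply: dis | apply: com _ _; eauto]; rewrite ?inE.
Qed.

(** On a component of G[S], [R] and [R'] each alternate between at most two disjoint sets. One
    permutation per component carries [R] to [R'], and recolouring by it is injective. Exchanging
    [R] and [R'] gives equality. *)
Lemma leq_card_balanced R R' S :
  balanced R S -> balanced R' S -> {in S, forall v, #|R v| = #|R' v|} ->
  #|partial_colourings R S| <= #|partial_colourings R' S|.
Proof.
move=> /balancedP[dis com] /balancedP[dis' com'] cR.
pose eS : rel T := fun u v => [&& u \in S, v \in S & e u v].
have eS_sym : symmetric eS by move=> u v; rewrite /eS e_sym andbCA.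
have eS_csym : connect_sym eS by apply: sym_connect_sym.
have recol x : exists s : {perm C}, x \in S -> forall z, connect eS x z -> s @: R z = R' z.
  case xS: (x \in S); last by exists 1%g.
  (* A vertex isolated in G[S] has one forbidden set to match; [set0] stands in for the second. *)
  have [/existsP[y xy]|no_nbr] := boolP [exists y, eS x y]; last first.
    have [||s [sx _]] := @perm_map_disjoint C (R x) set0 (R' x) set0 _ _ (cR x xS) erefl.
    - by rewrite disjoint_sym disjoints_subset sub0set.
    - by rewrite disjoint_sym disjoints_subset sub0set.
    exists s => _ z /connectP[[_ ->//|y p /= /andP[xy _] _]].
    by case/existsP: no_nbr; exists y.
  have /and3P[_ yS xye] := xy.
  have [||s [sx sy]] := perm_map_disjoint _ _ (cR x xS) (cR y yS); [exact: dis|exact: dis'|].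
  exists s => _ z xz.
  (* Following the pair along walks makes [R] and [R'] switch at the same vertices, so the same [s]
     works for both values. *)
  have pairE u v w : eS v u -> eS v w -> (R u, R' u) = (R w, R' w).
    move=> /and3P[vS uS vu] /and3P[_ wS vw].
    by rewrite (com u v w) // (com' u v w).
  by have [[[-> ->] _]|[[-> ->] _]] := connect_two_valued eS_sym pairE xy xz.
have [s sP] := fin_all_exists recol.
(* Choosing the permutation through the root gives adjacent vertices of [S] the same one, which
   keeps the colouring proper. *)
pose t v := s (root eS v).
have root_in v : v \in S -> root eS v \in S.
  have: connect eS (root eS v) v by rewrite eS_csym connect_root.
  by case/connectP=> -[|y p] /= => [_ <-|/andP[/and3P[]]].
have tP v : v \in S -> t v @: R v = R' v.
  by move=> vS; apply: sP; rewrite ?root_in // eS_csym connect_root.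
pose f a : {ffun T -> option C} := [ffun v => omap (t v) (a v)].
have f_inj : injective f.
  move=> a b /ffunP E; apply/ffunP => v; have := E v; rewrite !ffunE.
  by case: (a v) (b v) => [i|] [j|] //= [/perm_inj->].
rewrite -(card_imset _ f_inj); apply/subset_leq_card/subsetP => _ /imsetP[a + ->].
case/partial_colouringsP => dom prop perm; apply/partial_colouringsP; split.
- by move=> v; rewrite ffunE -dom; case: (a v).
- move=> u v uv uS; have := prop u v uv uS; rewrite !ffunE.
  case vS: (v \in S).
    have -> : t v = t u.
      rewrite /t; congr (s _); apply/eqP; rewrite root_connect //.
      by apply: connect1; rewrite /eS uS vS e_sym uv.
    by apply: contraNneq => E; apply/eqP; move: E; case: (a u) (a v) => [i|] [j|] //= [/perm_inj->].
  by move: (dom u) (dom v); rewrite uS vS; case: (a u) (a v) => [i|] [j|].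
- move=> v j; rewrite ffunE; case av: (a v) => [i|] //= [<-].
  have vS : v \in S by rewrite -dom av.
  by rewrite -tP // mem_imset ?(perm _ _ av) //; apply: perm_inj.
Qed.

(** * Explicit counts on stars, edges and paths with three vertices *)

(** Once the centre [v] has colour [j], the leaves are coloured independently of each other,
    avoiding [j] and their own forbidden sets. *)
Lemma card_star R v L :
  irreflexive e ->
  {in L, forall w, e v w} -> {in L &, forall u w, ~~ e u w} ->
  #|partial_colourings R (v |: L)| =
  \sum_(j | j \notin R v) \prod_(w in L) #|~: R w :\ j|.
Proof.
move=> e_irr vL indL.
have vnL : v \notin L by apply/negP => /vL; rewrite e_irr.
rewrite -sum1_card (partition_big (fun a => a v)
  (fun x => if x is Some j then j \notin R v else false)); last first.
  move=> a /partial_colouringsP[dom _ perm]; case av: (a v) => [j|].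
    exact: perm av.
  by have := dom v; rewrite av !inE eqxx.
rewrite (reindex_omap Some id); last by case.
apply: eq_big => [j|j]; rewrite ?eqxx ?andbT // => vj.
rewrite sum1dep_card.
transitivity #|pfamily None (v |: L) (fun w => if w == v then pred1 (Some j) else
   [pred x | if x is Some i then i \in ~: R w :\ j else false])|.
  rewrite cardsE; apply: eq_card => a; rewrite unfold_in; apply/andP/pfamilyP.
    case=> /partial_colouringsP[dom prop perm] /eqP av; split.
      by apply/subsetP => w; rewrite inE -dom; case: (a w).
    move=> w; have [-> _|wv] := eqVneq w v; first by rewrite inE av.
    rewrite !inE (negPf wv) /= => wL; have := dom w; rewrite !inE wL orbT.
    case aw: (a w) => [i|] // _; rewrite !inE (perm _ _ aw) andbT.
    have := prop v w (vL _ wL); rewrite !inE eqxx av aw => /(_ isT).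
    by move=> ne; apply: contraNneq ne => ->.
  case=> /subsetP supp fam.
  have av : a v = Some j by apply/eqP; have := fam v; rewrite !inE eqxx => /(_ isT).
  have aw w : w \in L -> exists i, [/\ a w = Some i, i \notin R w & i != j].
    move=> wL; have := fam w; rewrite !inE wL orbT => /(_ isT).
    rewrite (negPf (memPn vnL _ wL)) inE; case: (a w) => [i|] //.
    by rewrite !inE => /andP[ij iw]; exists i.
  have dom w : (a w : bool) = (w \in v |: L).
    apply/idP/idP => [|/setU1P[->|/aw[i [->]]]] //; last by rewrite av.
    by move=> awn; apply: supp; rewrite inE; case: (a w) awn.
  split; last by rewrite av.
  apply/partial_colouringsP; split=> //.
    move=> u w uw /setU1P[uv|uL].
      have [wL|wL] := boolP (w \in L); last first.
        have := dom w; rewrite !inE (negPf wL) orbF.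
        case: eqP => [wv|_]; first by rewrite uv wv e_irr in uw.
        by case: (a w) => //; rewrite uv av.
      have [i [-> _ ij]] := aw w wL.
      by rewrite uv av eq_sym; apply: contraNneq ij => -[->].
    have [i [-> _ ij]] := aw u uL.
    have [->|wv] := eqVneq w v.
      by rewrite av; apply: contraNneq ij => -[->].
    have [wL|wL] := boolP (w \in L); first by case/negP: (indL _ _ uL wL).
    by have := dom w; rewrite !inE (negPf wL) (negPf wv); case: (a w).
  move=> w i; have [->|wv] := eqVneq w v; first by rewrite av => -[<-].
  move=> awi; have := dom w; rewrite awi !inE (negPf wv) /= => /esym/aw[i' []].
  by rewrite awi => -[<-].
rewrite card_pfamily_prod big_setU1 //= eqxx card1 mul1n.
apply: eq_bigr => w wL; rewrite (negPf (memPn vnL _ wL)).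
have Some_inj : injective (@Some C) by move=> i i' [].
rewrite -(card_imset _ Some_inj); apply: eq_card => -[i|]; rewrite inE.
  by rewrite mem_imset.
by apply/esym/imsetP => -[].
Qed.

Lemma sum_bool_card (P Q : pred C) :
  \sum_(j | P j) (Q j : nat) = #|[set j | P j & Q j]|.
Proof.
rewrite -sum1dep_card big_mkcondr; apply: eq_bigr => j _.
by case: (Q j).
Qed.

Lemma sum_mul_bool_card (P Q : pred C) c :
  \sum_(j | P j) c * Q j = c * #|[set j | P j & Q j]|.
Proof. by rewrite -sum_bool_card big_distrr. Qed.

(** Excluding [j] costs one choice unless [j] was forbidden anyway. The indicator form lets the sum
    over [j] be expanded. *)
Lemma cardsCD1 (A : {set C}) j : 0 < #|~: A| -> #|~: A :\ j| = #|~: A|.-1 + (j \in A).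
Proof.
move=> A0; have := cardsD1 j (~: A); rewrite inE.
by case: (j \in A) => /=; lia.
Qed.

(** Each colour of [v] leaves [m.-1] choices for [u], plus one if that colour is forbidden at
    [u]. *)
Lemma card_edge R m v u :
  irreflexive e -> e v u -> (forall w, #|~: R w| = m) -> 0 < m ->
  #|partial_colourings R [set v; u]| = m * m.-1 + #|R u :\: R v|.
Proof.
move=> e_irr vu cR m0; rewrite card_star //; last 2 first.
- by move=> w /set1P->.
- by move=> w w' /set1P-> /set1P->; rewrite e_irr.
under eq_bigr => j _ do rewrite big_set1 cardsCD1 ?cR //.
rewrite big_split sum_nat_cond_const sum_bool_card /=.
congr (_ * _ + _).
by rewrite -(cR v); apply: eq_card => j; rewrite !inE.
Qed.

Lemma card_cherry R m v u w :
  irreflexive e -> e v u -> e v w -> ~~ e u w -> u != w ->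
  (forall z, #|~: R z| = m) -> 0 < m ->
  #|partial_colourings R (v |: [set u; w])| =
  m * m.-1 ^ 2 + m.-1 * (#|R u :\: R v| + #|R w :\: R v|) +
  #|(R u :&: R w) :\: R v|.
Proof.
move=> e_irr vu vw uw neq_uw cR m0; rewrite card_star //; last 2 first.
- by move=> z /set2P[]->.
- by move=> z z' /set2P[]-> /set2P[]->; rewrite ?e_irr // e_sym.
transitivity (\sum_(j | j \notin R v) (m.-1 ^ 2 + m.-1 * (j \in R u) + m.-1 * (j \in R w)
    + (j \in R u :&: R w))).
  apply: eq_bigr => j _; rewrite big_setU1 ?inE //= big_set1 !cardsCD1 ?cR // ?inE.
  by case: (j \in R u); case: (j \in R w); rewrite /= ?mulnDl ?mulnDr; lia.
have setR (A : {set C}) : [set j | j \notin R v & j \in A] = A :\: R v.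
  by apply/setP => j; rewrite !inE.
rewrite 3!big_split /= sum_nat_cond_const.
rewrite (sum_mul_bool_card _ (fun j => j \in R u)) (sum_mul_bool_card _ (fun j => j \in R w)).
rewrite (sum_bool_card _ (fun j => j \in R u :&: R w)) !setR mulnDr addnA.
have -> : #|[set j | j \notin R v]| = m.
  by rewrite -(cR v); apply: eq_card => j; rewrite !inE.
done.
Qed.

Lemma disjoint_setDE (A B : {set C}) : [disjoint A & B] -> A :\: B = A.
Proof. by rewrite -setI_eq0 setDE => /eqP AB; rewrite -[RHS](setID A B) AB set0U setDE. Qed.

Lemma eq_cardsC (A B : {set C}) : #|A| = #|B| -> #|~: A| = #|~: B|.
Proof. by move=> cAB; rewrite [LHS]cardsCs [RHS]cardsCs !setCK cAB. Qed.

(** The count depends on the restraint only through [#|R u :\: R v|], which reaches [k] exactly when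
    the two sets are disjoint. *)
Lemma ltn_card_edge R R' k v u :
  irreflexive e -> e v u -> (forall w, #|R w| = k) -> (forall w, #|R' w| = k) ->
  0 < k -> [disjoint R u & R v] -> ~~ [disjoint R' u & R' v] ->
  #|partial_colourings R' [set v; u]| < #|partial_colourings R [set v; u]|.
Proof.
move=> e_irr vu cR cR' k0 dis dis'.
have cRC z : #|~: R z| = #|~: R v| by apply: eq_cardsC; rewrite !cR.
have cRC' z : #|~: R' z| = #|~: R v| by apply: eq_cardsC; rewrite cR cR'.
have m0 : 0 < #|~: R v|.
  by rewrite (leq_trans k0) // -(cR u) subset_leq_card // -disjoints_subset.
rewrite (card_edge e_irr vu cRC m0) (card_edge e_irr vu cRC' m0) ltn_add2l (disjoint_setDE dis) cardsD cR cR'.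
by rewrite -setI_eq0 -card_gt0 in dis'; lia.
Qed.

(** Disjointness along both edges makes the first two terms of the count agree. What remains is the
    overlap of the two leaf sets, which is [k] only if they coincide. *)
Lemma ltn_card_cherry R R' k v u w :
  irreflexive e -> e v u -> e v w -> ~~ e u w ->
  (forall z, #|R z| = k) -> (forall z, #|R' z| = k) -> 0 < k ->
  [disjoint R u & R v] -> R u = R w ->
  [disjoint R' u & R' v] -> [disjoint R' w & R' v] -> R' u != R' w ->
  #|partial_colourings R' (v |: [set u; w])| <
  #|partial_colourings R (v |: [set u; w])|.
Proof.
move=> e_irr vu vw uw cR cR' k0 dis Ruw disu disw neq.
have neq_uw : u != w by apply: contraNneq neq => ->.
have cRC z : #|~: R z| = #|~: R v| by apply: eq_cardsC; rewrite !cR.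
have cRC' z : #|~: R' z| = #|~: R v| by apply: eq_cardsC; rewrite cR cR'.
have m0 : 0 < #|~: R v|.
  by rewrite (leq_trans k0) // -(cR u) subset_leq_card // -disjoints_subset.
rewrite (card_cherry _ _ _ _ _ cRC m0) // (card_cherry _ _ _ _ _ cRC' m0) // -Ruw setIid !disjoint_setDE //; last first.
  by apply: disjointWl disu; apply: subsetIl.
rewrite !cR !cR' ltn_add2l -(cR' u) proper_card // properEneq subsetIl andbT.
apply: contra neq => /eqP/setIidPl sub.
by rewrite eqEcard sub !cR' leqnn.
Qed.

End Colours.

(** * Unrestrained colourings, and the split into low and high colours *)

Lemma card_pred_odd n b : n./2 <= #|[pred i : 'I_n | odd i == b]|.
Proof.
have lt_i (i : 'I_n./2) : i.*2 + b < n.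
  by have := ltn_ord i; have := odd_double_half n; case: b; lia.
pose f i := Ordinal (lt_i i).
have f_inj : injective f.
  by move=> i j /(congr1 val) /= /addIn/double_inj/val_inj.
rewrite -[X in X <= _]card_ord -(card_codom f_inj).
apply/subset_leq_card/subsetP => _ /codomP[i ->].
by rewrite inE /= oddD odd_double addFb; case: (b).
Qed.

Lemma card_free_le y (S : {set T}) :
  #|partial_colourings (fun _ => set0 : {set 'I_y}) S| <= y ^ #|S|.
Proof.
pose F := fun _ : T => predC1 (@None 'I_y).
apply: (@leq_trans #|pfamily None S F|).
  apply/subset_leq_card/subsetP => a /partial_colouringsP[dom _ _].
  apply/pfamilyP; split=> [|v vS]; last by have := dom v; rewrite vS !inE; case: (a v).
  by apply/subsetP => v; rewrite inE -dom; case: (a v).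
by rewrite card_pfamily_prod /F prod_nat_const cardC1 card_option card_ord.
Qed.

(** Reserving the even colours for one side and the odd colours for the other makes every choice
    proper, with at least [y./2] colours per vertex. *)
Lemma card_free_ge (side : T -> bool) y (S : {set T}) :
  (forall u v, e u v -> side u != side v) ->
  y./2 ^ #|S| <= #|partial_colourings (fun _ => set0 : {set 'I_y}) S|.
Proof.
move=> sideP.
pose F v := [pred x : option 'I_y | if x is Some i then odd i == side v else false].
apply: (@leq_trans #|pfamily None S F|).
  rewrite card_pfamily_prod -prod_nat_const; apply: leq_prod => v _.
  apply: leq_trans (card_pred_odd y (side v)) _.
  have Some_inj : injective (@Some 'I_y) by move=> i j [].
  rewrite -(card_image Some_inj); apply/subset_leq_card/subsetP => _ /imageP[i + ->].
  by rewrite !inE.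
apply/subset_leq_card/subsetP => a /pfamilyP[/subsetP supp fam].
have dom v : (a v : bool) = (v \in S).
  apply/idP/idP => [av|/fam]; last by rewrite inE; case: (a v).
  by apply: supp; rewrite inE; case: (a v) av.
apply/partial_colouringsP; split=> // [u v uv uS|v j _]; last by rewrite inE.
have := fam u uS; rewrite inE; case: (a u) => [i|] // /eqP oi.
have [/fam|] := boolP (v \in S); last by rewrite -dom; case: (a v).
rewrite inE; case: (a v) => [j|] // /eqP oj.
by apply: contraNneq (sideP _ _ uv) => -[ij]; rewrite -oi -oj ij.
Qed.

(** The forbidden colours among 1..M as a finite set; nothing is lost for a k-restraint when M = k
    n. *)
Definition low_colours M (r : restraint T) (v : T) : {set 'I_M} :=
  [set j | colour j \in r v].

(** [None] marks a high colour, in accordance with [None] for vertices outside [S] in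
    [partial_colourings]. *)
Definition low M y (i : 'I_(M + y)) : option 'I_M :=
  if split i is inl j then Some j else None.

Definition high M y (i : 'I_(M + y)) : option 'I_y :=
  if split i is inr j then Some j else None.

Lemma low_lshift M y j : low (@lshift M y j) = Some j.
Proof. by rewrite /low (unsplitK (inl j)). Qed.

Lemma low_rshift M y j : low (@rshift M y j) = None.
Proof. by rewrite /low (unsplitK (inr j)). Qed.

Lemma high_lshift M y j : high (@lshift M y j) = None.
Proof. by rewrite /high (unsplitK (inl j)). Qed.

Lemma high_rshift M y j : high (@rshift M y j) = Some j.
Proof. by rewrite /high (unsplitK (inr j)). Qed.

Definition low_highE := (low_lshift, low_rshift, high_lshift, high_rshift).

Lemma low_high_inj M y (i j : 'I_(M + y)) : low i = low j -> high i = high j -> i = j.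
Proof.
by case: (split_ordP i) => i' ->; case: (split_ordP j) => j' ->;
  rewrite !low_highE => ll hh; congruence.
Qed.

(** A low and a high colour never clash and high colours are never forbidden, so for a fixed set [S]
    of low vertices the two parts of the colouring are independent. *)
Lemma num_permitted_split M y (r : restraint T) :
  (forall v i, i \in r v -> i <= M) ->
  num_permitted e r (M + y) =
  \sum_S #|partial_colourings (low_colours M r) S| *
         #|partial_colourings (fun _ => set0 : {set 'I_y}) (~: S)|.
Proof.
move=> rM; rewrite /num_permitted -sum1_card.
rewrite (partition_big (fun c : {ffun T -> 'I_(M + y)} => [set v | (low (c v) : bool)]) predT) //=.
apply: eq_bigr => S _; rewrite sum1dep_card -cardsX.
pose f (c : {ffun T -> 'I_(M + y)}) :=
  ([ffun v => low (c v)], [ffun v => high (c v)]).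
have f_inj : injective f.
  move=> c d [/ffunP lcd /ffunP hcd]; apply/ffunP => v.
  by apply: low_high_inj; [have := lcd v | have := hcd v]; rewrite !ffunE.
rewrite -(card_imset _ f_inj); apply: eq_card => -[a b].
rewrite in_setX; apply/imsetP/andP => /= [[c cP [-> ->]]|].
  rewrite !inE in cP; case/andP: cP => /andP[prop perm] /eqP cS.
  have domS v : (low (c v) : bool) = (v \in S) by rewrite -cS inE.
  have propc u v : e u v -> c u != c v.
    by move=> uv; move/forallP/(_ u)/forallP/(_ v): prop; rewrite uv.
  split; apply/partial_colouringsP; split.
  - by move=> v; rewrite ffunE.
  - move=> u v uv; rewrite !ffunE -domS; have := propc u v uv.
    case: (split_ordP (c u)) => i ->; case: (split_ordP (c v)) => j ->; rewrite ?low_highE //.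
  - move=> v j; rewrite ffunE inE; move/forallP/(_ v): perm.
    by case: (split_ordP (c v)) => i -> + //; rewrite low_highE // => + [<-].
  - by move=> v; rewrite ffunE inE -domS; case: (split_ordP (c v)) => j ->; rewrite ?low_highE.
  - move=> u v uv; rewrite !ffunE inE -domS; have := propc u v uv.
    case: (split_ordP (c u)) => i ->; case: (split_ordP (c v)) => j ->; rewrite ?low_highE //.
    by move=> ne _; apply: contraNneq ne => -[->].
  - by move=> v j _; rewrite inE.
case=> /partial_colouringsP[doma propa perma] /partial_colouringsP[domb propb _].
(* The domains of [a] and [b] are complementary, so exactly one of them supplies the colour of
   [v]. *)
have merge v : exists i : 'I_(M + y), a v = low i /\ b v = high i.
  move: (doma v) (domb v); rewrite inE; case: (v \in S).
    by case: (a v) (b v) => [i|] [j|] // _ _; exists (lshift y i); rewrite !low_highE.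
  by case: (a v) (b v) => [i|] [j|] // _ _; exists (rshift M j); rewrite !low_highE.
have [c cP] := fin_all_exists merge.
exists [ffun v => c v]; last first.
  by congr (_, _); apply/ffunP => v; rewrite !ffunE; case: (cP v).
rewrite !inE -andbA; apply/and3P; split.
- apply/'forall_forallP => u v; apply/implyP => uv; rewrite !ffunE.
  have [uS|uS] := boolP (u \in S).
    have := propa u v uv uS; rewrite (cP u).1 (cP v).1.
    by move=> ne; apply: contraNneq ne => ->.
  have := propb u v uv; rewrite inE uS (cP u).2 (cP v).2 => /(_ isT).
  by move=> ne; apply: contraNneq ne => ->.
- apply/forallP => v; rewrite ffunE; have := perma v; rewrite (cP v).1.
  case: (split_ordP (c v)) => i ->; rewrite low_highE.
    by move/(_ i erefl); rewrite inE.
  by move=> _; apply/negP => /rM; rewrite /colour /=; lia.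
- by apply/eqP/setP => v; rewrite inE ffunE -doma (cP v).1.
Qed.

End PartialColourings.

(** * Asymptotic comparison at the smallest differing vertex set *)

Section Comparison.
Variables (T : finType) (e : rel T) (side : T -> bool).
Hypotheses (e_sym : symmetric e) (e_irr : irreflexive e).
Hypothesis sideP : forall u v, e u v -> side u != side v.

(* Each extra vertex in [S] costs a factor of order [y] in the number of
   colourings of the complement, so the smallest difference decides. *)
Lemma eventually_sum_lt (p p' : {set T} -> nat) (S0 : {set T}) :
  (forall S : {set T}, #|S| <= #|S0| -> p' S <= p S) -> p' S0 < p S0 ->
  exists N, forall y, N <= y ->
    \sum_S p' S * #|partial_colourings e (fun _ => set0 : {set 'I_y}) (~: S)| <
    \sum_S p S * #|partial_colourings e (fun _ => set0 : {set 'I_y}) (~: S)|.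
Proof.
(* With z = [y./2], the bounds y^d and z^d on the free colourings of d vertices differ by a factor
   of at most 3^d, since y <= 3z. Taking z above [K] absorbs this factor and all the weights
   [p' S]. *)
move=> le_p lt_p; pose K := (\sum_S p' S) * 3 ^ #|T|.
exists K.+1.*2 => y Ky.
pose q (S : {set T}) := #|partial_colourings e (fun _ => set0 : {set 'I_y}) (~: S)|.
have y3 : y <= 3 * y./2 by have := odd_double_half y; lia.
have zK : K < y./2 by have := odd_double_half y; lia.
have z0 : 0 < y./2 by apply: leq_ltn_trans zK.
have q_ge : y./2 ^ #|~: S0| <= q S0 by apply: card_free_ge sideP.
have q_le (S : {set T}) : #|S0| < #|S| -> y./2 * q S <= 3 ^ #|T| * q S0.
  move=> ltS.
  have ltC : #|~: S| < #|~: S0| by have := cardsC S; have := cardsC S0; lia.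
  have q_leS : q S <= (3 * y./2) ^ #|~: S|.
    apply: leq_trans (card_free_le e y _) _.
    by case: #|_| => [|d]; rewrite ?expn0 // leq_exp2r.
  apply: leq_trans (leq_mul (leqnn _) q_leS) _.
  rewrite expnMn mulnCA -expnS leq_mul ?leq_pexp2l ?max_card //.
  by apply: leq_trans q_ge; rewrite leq_pexp2l.
(* The strict inequality at [S0] gains at least [q S0], so it suffices that all larger sets together
   contribute less. *)
have tail : \sum_(S : {set T} | ~~ (#|S| <= #|S0|)) p' S * q S < q S0.
  rewrite -(ltn_pmul2l z0) big_distrr /=.
  apply: (@leq_ltn_trans (K * q S0)); last first.
    by rewrite ltn_pmul2r // (leq_trans _ q_ge) // expn_gt0 z0.
  rewrite /K -mulnA big_distrl [leqRHS](bigID (fun S : {set T} => #|S| <= #|S0|)) /=.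
  apply: leq_trans (leq_addl _ _); apply: leq_sum => S; rewrite -ltnNge => /q_le qS.
  by rewrite mulnCA leq_mul.
rewrite -[ltnLHS]/(\sum_S p' S * q S) -[ltnRHS]/(\sum_S p S * q S).
rewrite (bigID (fun S : {set T} => #|S| <= #|S0|)) /=.
rewrite [ltnRHS](bigID (fun S : {set T} => #|S| <= #|S0|)) /=.
apply: leq_trans (leq_addr _ _); rewrite (bigD1 S0) //= [leqRHS](bigD1 S0) //=.
have rest : \sum_(S : {set T} | (#|S| <= #|S0|) && (S != S0)) p' S * q S <=
    \sum_(S : {set T} | (#|S| <= #|S0|) && (S != S0)) p S * q S.
  by apply: leq_sum => S /andP[/le_p leS _]; rewrite leq_mul2r leS orbT.
have top : p' S0 * q S0 + q S0 <= p S0 * q S0 by rewrite -mulSnr leq_mul2r lt_p orbT.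
rewrite -addnS -addnA; apply: leq_trans (leq_add top rest).
by rewrite -addnA leq_add2l addnC leq_add2r.
Qed.

Lemma subset_leq_card_eq (A B : {set T}) : A \subset B -> #|B| <= #|A| -> B = A.
Proof. by move=> AB cBA; apply/esym/eqP; rewrite eqEcard AB. Qed.

Lemma card_cherry_set u v w : e v u -> e v w -> u != w -> #|v |: [set u; w]| = 3.
Proof.
move=> vu vw uw; rewrite cardsU1 cards2 uw !inE negb_or.
have ne x : e v x -> v != x by apply: contraTneq => ->; rewrite e_irr.
by rewrite !ne.
Qed.

(** Take for [S0] an edge whose sets meet or, if there is none, a path on three vertices whose end
    sets differ. A set no larger than [S0] is either balanced for [R'] or itself such an edge or
    path. *)
Lemma unbalanced_witness (C : finType) (R R' : T -> {set C}) k :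
  0 < k -> (forall v, #|R v| = k) -> (forall v, #|R' v| = k) ->
  balanced e R [set: T] -> ~~ balanced e R' [set: T] ->
  exists2 S0 : {set T},
    forall S : {set T}, #|S| <= #|S0| ->
      #|partial_colourings e R' S| <= #|partial_colourings e R S| &
    #|partial_colourings e R' S0| < #|partial_colourings e R S0|.
Proof.
move=> k0 cR cR' balR unbal.
have /balancedP[dis com] := balR.
have bal_le S : balanced e R' S ->
    #|partial_colourings e R' S| <= #|partial_colourings e R S|.
  move=> bal; apply: leq_card_balanced => //; first exact: balancedW.
  by move=> v _; rewrite cR.
have edge_lt v u : e v u -> ~~ [disjoint R' u & R' v] ->
    #|partial_colourings e R' [set v; u]| < #|partial_colourings e R [set v; u]|.
  move=> vu; apply: ltn_card_edge => //; rewrite ?dis ?inE //.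
  by rewrite e_sym.
have [/existsP[v /existsP[u /andP[vu ndis]]]|nedge] :=
    boolP [exists v, exists u, e v u && ~~ [disjoint R' u & R' v]].
  have card_S0 : #|[set v; u]| = 2.
    by rewrite cards2 (_ : v != u) //; apply: contraTneq vu => ->; rewrite e_irr.
  exists [set v; u] => [S|]; last exact: edge_lt.
  rewrite card_S0 => cS; have [|/balancedP nbal] := boolP (balanced e R' S); first exact: bal_le.
  have [/exists_inP[x xS /exists_inP[z zS /andP[xz nd]]]|nexy] :=
      boolP [exists x in S, exists z in S, e x z && ~~ [disjoint R' z & R' x]].
    rewrite (@subset_leq_card_eq [set x; z] S) ?(ltnW (edge_lt _ _ xz nd)) //.
      by apply/subsetP => t /set2P[]->.
    by rewrite cards2 (_ : x != z) //; apply: contraTneq xz => ->; rewrite e_irr.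
  case: nbal; split=> [x z xS zS xz|x z t xS zS tS zx zt].
    apply: contraNT nexy => nd; apply/exists_inP; exists x => //.
    by apply/exists_inP; exists z => //; rewrite xz disjoint_sym.
  (* Distinct neighbours of [z] would put three vertices into [S], which has at most two. *)
  have [->//|xt] := eqVneq x t.
  have := card_cherry_set zx zt xt; suff : #|z |: [set x; t]| <= #|S| by lia.
  by apply/subset_leq_card/subsetP => s; rewrite !inE => /or3P[]/eqP->.
have dis' u v : e u v -> [disjoint R' u & R' v].
  move=> uv; apply: contraNT nedge => nd; apply/existsP; exists v.
  by apply/existsP; exists u; rewrite e_sym uv.
have cherry_lt u v w : e v u -> e v w -> R' u != R' w ->
    #|partial_colourings e R' (v |: [set u; w])| <
    #|partial_colourings e R (v |: [set u; w])|.
  move=> vu vw; apply: (@ltn_card_cherry T e e_sym C R R' k v u w) => //.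
  (* Both ends lie on the side opposite to [v], so the path is induced. *)
  - apply/negP => /sideP; move: (sideP vu) (sideP vw).
    by case: (side v); case: (side u); case: (side w).
  - by apply: dis; rewrite ?inE // e_sym.
  - by apply: (com u v w); rewrite ?inE.
  - by apply: dis'; rewrite e_sym.
  - by apply: dis'; rewrite e_sym.
have [/existsP[v /existsP[u /existsP[w /and3P[vu vw neq]]]]|nch] :=
    boolP [exists v, exists u, exists w, [&& e v u, e v w & R' u != R' w]]; last first.
  case/negP: unbal; apply/balancedP; split=> [u v _ _|u v w _ _ _ vu vw]; first exact: dis'.
  apply: contraNeq nch => neq; apply/existsP; exists v; apply/existsP; exists u.
  by apply/existsP; exists w; rewrite vu vw.
have RneqW x z : R' x != R' z -> x != z by apply: contraNneq => ->.
exists (v |: [set u; w]) => [S|]; last exact: cherry_lt.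
rewrite card_cherry_set ?RneqW // => cS.
have [|/balancedP nbal] := boolP (balanced e R' S); first exact: bal_le.
have [/exists_inP[y yS /exists_inP[x xS /exists_inP[z zS /and3P[yx yz nxz]]]]|nch] :=
    boolP [exists y in S, exists x in S, exists z in S, [&& e y x, e y z & R' x != R' z]].
  rewrite (@subset_leq_card_eq (y |: [set x; z]) S) ?(ltnW (cherry_lt _ _ _ yx yz nxz)) //.
    by apply/subsetP => t; rewrite !inE => /or3P[]/eqP->.
  by rewrite card_cherry_set ?RneqW.
case: nbal; split=> [x y xS yS|x y z xS yS zS yx yz]; first exact: dis'.
apply: contraNeq nch => neq'; apply/exists_inP; exists y => //.
apply/exists_inP; exists x => //; apply/exists_inP; exists z => //.
by rewrite yx yz.
Qed.

End Comparison.

(** * The two sides of a bipartition *)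

Section Bipartition.
Variables (T : finType) (e : rel T) (V1 V2 : {set T}).
Hypothesis V12 : bipartition e V1 V2.

Lemma bipartition_setC : V2 = ~: V1.
Proof.
case: V12 => /setP U /setP I _; apply/setP => v; move: (U v) (I v); rewrite !inE.
by case: (v \in V1); case: (v \in V2).
Qed.

Lemma bipartition_edge u v : e u v -> (u \in V1) != (v \in V1).
Proof.
case: V12 => _ _ eV /eV; rewrite bipartition_setC !inE.
by case: (u \in V1); case: (v \in V1).
Qed.

End Bipartition.

(** * Balanced and alternating k-restraints *)

Section KRestraints.
Variables (T : finType) (k : nat).
Implicit Type r : restraint T.

Lemma mem_low_colours r v i :
  k_restraint k r -> i \in r v ->
  exists2 j, j \in low_colours (k * #|T|) r v & i = colour j.
Proof.
move=> rk iv; have /andP[i0 iM] := (rk v).2 i iv.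
have ltM : i.-1 < k * #|T| by rewrite prednK.
by exists (Ordinal ltM); rewrite ?inE /colour /= prednK.
Qed.

Lemma card_low_colours r v : k_restraint k r -> #|low_colours (k * #|T|) r v| = k.
Proof.
move=> rk; rewrite -[RHS](rk v).1 cardE -(size_map (@colour _)).
apply/perm_size/uniq_perm; rewrite ?fset_uniq //.
  by rewrite map_inj_uniq ?enum_uniq // => i j [] /val_inj.
move=> i; apply/mapP/idP => [[j + ->]|/(mem_low_colours rk)[j jv ->]].
  by rewrite mem_enum inE.
by exists j; rewrite ?mem_enum.
Qed.

Lemma low_colours_inj r u v : k_restraint k r ->
  low_colours (k * #|T|) r u = low_colours (k * #|T|) r v -> r u = r v.
Proof.
move=> rk E; apply/fsetP => i; apply/idP/idP => /(mem_low_colours rk)[j + ->].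
  by rewrite E inE.
by rewrite -E inE.
Qed.

Lemma disjoint_low_colours r u v : k_restraint k r ->
  [disjoint low_colours (k * #|T|) r u & low_colours (k * #|T|) r v] =
  ((r u `&` r v)%fset == fset0).
Proof.
move=> rk; apply/idP/eqP => [dis|E].
  apply/fsetP => i; rewrite in_fsetI in_fset0; apply/negP => /andP[iu iv].
  have [j ju ij] := mem_low_colours rk iu.
  by have := disjointFr dis ju; rewrite inE -ij iv.
rewrite disjoint_subset; apply/subsetP => j; rewrite !inE => ju.
by apply/negP => jv; have := in_fset0 (colour j); rewrite -E in_fsetI ju jv.
Qed.

Variable e : rel T.
Hypothesis e_sym : symmetric e.

Lemma component_connected H u v : H \in components e -> u \in H -> v \in H -> connect e u v.
Proof.
case/imsetP => x _ ->; rewrite !inE => xu xv; apply: connect_trans xv.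
by rewrite sym_connect_sym.
Qed.

(** The parts of a component are the traces of the global bipartition. Connectedness spreads the
    local conditions over the whole component. *)
Lemma balanced_alternating r V1 V2 :
  k_restraint k r -> bipartition e V1 V2 ->
  balanced e (low_colours (k * #|T|) r) [set: T] <->
  (forall H : {set T}, H \in components e ->
     alternating (induced e H) k (restrict r H)).
Proof.
move=> rk V12; split=> [/balancedP[dis com] H HC|alt].
  split=> [v|]; first exact: (rk (val v)).1.
  have V2E v : (v \in V2) = (v \notin V1) by rewrite (bipartition_setC V12) inE.
  have side := bipartition_edge V12.
  (* Recording the side along with the forbidden set shows which of the two values a vertex takes:
     vertices of a component on the same side share it. *)
  pose f v := (low_colours (k * #|T|) r v, v \in V1).
  have fE u v w : e v u -> e v w -> f u = f w.
    move=> vu vw; rewrite /f (com u v w) ?inE //; congr (_, _).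
    by move: (side _ _ vu) (side _ _ vw); case: (v \in V1); case: (u \in V1); case: (w \in V1).
  have same u v : connect e u v -> (u \in V1) = (v \in V1) -> r u = r v.
    move=> uv uvV1.
    have [/existsP[n un]|nn] := boolP [exists n, e u n]; last first.
      case/connectP: uv => -[_ -> //|n p /= /andP[un _] _].
      by case/existsP: nn; exists n.
    have [[[E _] _]|[[_ E] _]] := connect_two_valued e_sym fE un uv.
      exact/esym/(low_colours_inj rk).
    by have := side _ _ un; rewrite -E uvV1 eqxx.
  exists [set v | val v \in V1], [set v | val v \in V2]; split.
  - split=> [||u v uv]; first by apply/setP => v; rewrite !inE V2E orbN.
      by apply/setP => v; rewrite !inE V2E andbN.
    by have := side _ _ uv; rewrite !inE !V2E; case: (val u \in V1); case: (val v \in V1).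
  - move=> u v; rewrite !inE => uV vV; apply: same; last by rewrite uV vV.
    by apply: (component_connected HC); apply: valP.
  - move=> u v; rewrite !inE !V2E => uV vV; apply: same; last by rewrite (negPf uV) (negPf vV).
    by apply: (component_connected HC); apply: valP.
  move=> u v; rewrite !inE V2E => uV vV; apply/eqP.
  rewrite -disjoint_low_colours //.
  have uv : connect e (val u) (val v) by apply: (component_connected HC); apply: valP.
  have [/existsP[n un]|nn] := boolP [exists n, e (val u) n]; last first.
    case/connectP: uv => -[_ E|n p /= /andP[un _] _]; first by rewrite E /= uV in vV.
    by case/existsP: nn; exists n.
  have [[[_ E] _]|[[-> _] _]] := connect_two_valued e_sym fE un uv.
    by rewrite E uV in vV.
  by apply: dis; rewrite ?inE.
(* Conversely, a vertex and its neighbours lie in one component, where all its neighbours belong to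
   the same part. *)
have compP v : exists2 H, H \in components e & forall u, connect e v u -> u \in H.
  by exists [set u | connect e v u] => [|u]; [apply: imset_f; rewrite inE | rewrite inE].
apply/balancedP; split=> [u v _ _ uv|u v w _ _ _ vu vw].
  have [H HC HP] := compP u; have [_ [W1 [W2 [[_ _ eW] _ _ dW]]]] := alt H HC.
  have uH : u \in H by apply: HP.
  have vH : v \in H by apply/HP/connect1.
  rewrite disjoint_low_colours //; apply/eqP.
  have /orP[/andP[uW vW]|/andP[uW vW]] := eW (exist _ u uH) (exist _ v vH) uv.
    exact: dW uW vW.
  by rewrite fsetIC; apply: dW vW uW.
have [H HC HP] := compP v; have [_ [W1 [W2 [[_ /setP W0 eW] c1 c2 _]]]] := alt H HC.
have vH : v \in H by apply: HP.
have uH : u \in H by apply/HP/connect1.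
have wH : w \in H by apply/HP/connect1.
suff E : r u = r w by rewrite /low_colours E.
have := eW (exist _ v vH) (exist _ u uH) vu; have := eW (exist _ v vH) (exist _ w wH) vw.
have := W0 (exist _ v vH); rewrite !inE.
case: (exist _ v vH \in W1); case: (exist _ v vH \in W2) => //= _; rewrite ?orbF.
  exact: (fun a b => c2 _ _ b a).
exact: (fun a b => c1 _ _ b a).
Qed.

(** Forbid 1..k on [V1] and k+1..2k elsewhere. Two vertices are needed for 2k <= k n. *)
Lemma exists_balanced V1 V2 : 1 < #|T| -> bipartition e V1 V2 ->
  exists2 r, k_restraint k r & balanced e (low_colours (k * #|T|) r) [set: T].
Proof.
move=> T1 V12.
pose r v := seq_fset tt (iota (if v \in V1 then 1 else k.+1) k).
have rk : k_restraint k r.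
  move=> v; rewrite /r size_seq_fset undup_id ?iota_uniq // size_iota; split=> // i.
  by rewrite seq_fsetE mem_iota; case: (v \in V1); nia.
have side := bipartition_edge V12.
exists r => //; apply/balancedP; split=> [u v _ _ /side uv|u v w _ _ _ /side vu /side vw].
  rewrite disjoint_low_colours //; apply/eqP/fsetP => i.
  rewrite in_fsetI in_fset0 !seq_fsetE !mem_iota.
  by move: uv; case: (u \in V1); case: (v \in V1) => // _; lia.
have E : (u \in V1) = (w \in V1).
  by move: vu vw; case: (v \in V1); case: (u \in V1); case: (w \in V1).
by rewrite /low_colours /r E.
Qed.

End KRestraints.

(** * Balanced restraints are exactly the optimal ones *)

Theorem corollary4p8 (T : finType) (e : rel T)
    (e_sym : symmetric e) (e_irr : irreflexive e) (e_bip : bipartite e)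
    (k : nat) (k_gt0 : 0 < k) (r : restraint T) (r_k : k_restraint k r) :
  Rmax e k r <->
  (forall H : {set T}, H \in components e ->
     alternating (induced e H) k (restrict r H)).
Proof.
have [V1 [V2 V12]] := e_bip; have side := bipartition_edge V12.
rewrite -(balanced_alternating e_sym r_k V12).
set M := k * #|T|.
have splitE r' y : k_restraint k r' -> num_permitted e r' (M + y) = _ :=
  fun rk' => @num_permitted_split T e M y r' (fun v i iv => proj2 (andP ((rk' v).2 i iv))).
have lt_eventually r1 r2 : k_restraint k r1 -> k_restraint k r2 ->
    balanced e (low_colours M r1) [set: T] -> ~~ balanced e (low_colours M r2) [set: T] ->
    exists N, forall x, N <= x -> num_permitted e r2 x < num_permitted e r1 x.
  move=> rk1 rk2 b1 b2.
  have [S0 le_S lt_S0] := unbalanced_witness e_sym e_irr side k_gt0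
    (fun v => card_low_colours v rk1) (fun v => card_low_colours v rk2) b1 b2.
  have [N NP] := eventually_sum_lt side le_S lt_S0.
  exists (M + N) => x Nx; have -> : x = M + (x - M) by lia.
  by rewrite !splitE //; apply: NP; lia.
split=> [[_ max]|bal].
  apply/negPn/negP => nbal.
  (* With at most one vertex there are no edges and every restraint is balanced, so [nbal] forces a
     second vertex and a balanced competitor exists. *)
  have T1 : 1 < #|T|.
    rewrite ltnNge; apply: contra nbal => /card_le1_eqP T1.
    apply/balancedP; split=> [u v _ _|u v w _ _ _ _ _]; last by rewrite (T1 u w).
    by rewrite (T1 u v) ?inE // e_irr.
  have [r0 rk0 b0] := exists_balanced k T1 V12.
  have [N NP] := lt_eventually _ _ rk0 r_k b0 nbal.
  have [N' NP'] := max r0 rk0.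
  have := NP (maxn N N') (leq_maxl _ _).
  by rewrite ltnNge NP' // leq_maxr.
split=> // r' rk'.
(* Two balanced restraints are compared term by term in the sum over [S]; an unbalanced [r']
   eventually loses strictly. *)
have [b'|nb'] := boolP (balanced e (low_colours M r') [set: T]).
  exists M => x Mx; rewrite -(subnKC Mx) !splitE //.
  apply: leq_sum => S _; apply: leq_mul (leqnn _).
  apply: leq_card_balanced => [//|||v _]; [exact: balancedW | exact: balancedW |].
  by rewrite !card_low_colours.
have [N NP] := lt_eventually _ _ r_k rk' bal nb'.
by exists N => x /NP/ltnW.
Qed.
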